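(* Let $H\in(0,1)$ be unknown and $\theta$ be known, and let $u(t)=\sum_{k\ge1}u_k(t)h_k$ be the solution of the diagonalizable equation $du(t)=(\mathcal{A}_0+\theta\mathcal{A}_1)u(t)\,dt+\mathcal{M}u(t)\,dW^H(t)$, whose Fourier coefficients $u_k(t)$ are observed. For non-zero Fourier coefficients $u_k,u_m$ write $v_k=v_k(t)=\ln(u_k(t)/u_k(0))$ and $v_m=v_m(t)=\ln(u_m(t)/u_m(0))$. Then the following exact estimate for the Hurst parameter holds: $$H=\frac{1}{2\ln t}\ln\left[\frac{(\rho_k+\theta\nu_k)t\mu_m-(\rho_m+\theta\nu_m)t\mu_k-v_k\mu_m+v_m\mu_k}{2\mu_k\mu_m(\mu_k-\mu_m)}\right],$$ for any $t>0$ and $k\neq m$, under the assumption that the expression under the logarithm is positive and finite.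
   Context: $W^H$ is a fractional Brownian motion with Hurst parameter $H$: a zero-mean Gaussian process with $\mathbb{E}W^H(t)W^H(s)=\frac12(t^{2H}+s^{2H}-|t-s|^{2H})$, $t,s\ge0$. $\mathcal{A}_0,\mathcal{A}_1,\mathcal{M}$ are known linear operators in a separable Hilbert space and $\theta$ is a real parameter. The equation is called diagonalizable if these operators have point spectrum and a common system of eigenfunctions $\{h_k\}_{k\ge1}$ (a complete orthonormal system); write $\mathcal{A}_0h_k=\rho_kh_k$, $\mathcal{A}_1h_k=\nu_kh_k$, $\mathcal{M}h_k=\mu_kh_k$. The solution (assumed to exist) is by definition $u(t)=\sum_{k\ge1}u_k(t)h_k$ with $$u_k(t)=u_k(0)\exp\left((\rho_k+\theta\nu_k)t-\tfrac12\mu_k^2t^{2H}+\mu_kW^H(t)\right),$$ where the $u_k(0)$ are the Fourier coefficients of the deterministic initial condition. Thus, for every non-zero Fourier coefficient, $v_k(t)=(\rho_k+\theta\nu_k)t-\frac12\mu_k^2t^{2H}+\mu_kW^H(t)$, and the estimate is obtained by solving for $H$ the system of two such equations, for the indices $k$ and $m$. An exact estimate is one that produces the exact value of the parameter of interest, here from finitely many Fourier coefficients.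
   Formalization: The printed expression under the logarithm equals t^{2H}/4, so the printed formula gives H − ln 2/ln t; the factor 2 is moved from the denominator to the numerator, and t = 1, where 1/(2 ln t) is undefined, is excluded. *)

(* Defs.v *)
From HB Require Import structures.
From mathcomp Require Import all_boot all_order all_algebra.
From mathcomp Require Import all_classical all_reals all_analysis.
Set Implicit Arguments.
Unset Strict Implicit.
Unset Printing Implicit Defensive.
Import Order.TTheory GRing.Theory Num.Theory.
Import numFieldNormedType.Exports.
Local Open Scope classical_set_scope.
Local Open Scope ring_scope.

Definition is_gaussian d (Omega : measurableType d) (R : realType)
    (P : probability Omega R) (X : {RV P >-> R}) : Prop :=
  exists m s : R, 0 <= s /\
    forall A : set R, measurable A ->
      distribution P X A =
        (* [normal_prob m 0] is a uniform law in the library; the degenerate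
           Gaussian is the Dirac mass. *)
        if s == 0 then \d_m A else normal_prob m s A.

Definition fractional_brownian_motion d (Omega : measurableType d)
    (R : realType) (P : probability Omega R) (H : R)
    (W : R -> {RV P >-> R}) : Prop :=
  [/\ forall (n : nat) (a s : 'I_n -> R), (forall i, 0 <= s i) ->
        is_gaussian (P := P) (\sum_(i < n) a i *: W (s i)),
      forall t : R, 0 <= t -> ('E_P[W t] = 0)%E
    & forall t s : R, 0 <= t -> 0 <= s ->
        ('E_P[fun w => (W t w * W s w)%R] =
          (2^-1 * (t `^ (2 * H) + s `^ (2 * H) - `|t - s| `^ (2 * H)))%R%:E)%E].

Definition separable_hilbert (R : realType) (V : completeNormedModType R)
    (ip : {dot V for (idfun : R -> R)}) : Prop :=
  (forall x : V, `|x| = Num.sqrt (ip x x)) /\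
  exists2 D : set V, countable D & dense D.

Definition complete_orthonormal (R : realType) (V : completeNormedModType R)
    (ip : {dot V for (idfun : R -> R)}) (h : nat -> V) : Prop :=
  (forall i j, ip (h i) (h j) = (i == j)%:R) /\
  (forall x : V, (forall k, ip x (h k) = 0) -> x = 0).

(* Possibly unbounded: the values of [op_fun] off [op_dom] are irrelevant. *)
Record linear_operator (R : realType) (V : lmodType R) := LinearOperator {
  op_dom : set V;
  op_fun : V -> V;
  op_dom0 : op_dom 0;
  op_domP : forall (a : R) (x y : V),
    op_dom x -> op_dom y -> op_dom (a *: x + y);
  op_linear : forall (a : R) (x y : V),
    op_dom x -> op_dom y -> op_fun (a *: x + y) = a *: op_fun x + op_fun y }.

Definition eigenpair (R : realType) (V : lmodType R)
    (A : linear_operator V) (lambda : R) (v : V) : Prop :=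
  [/\ v != 0, op_dom A v & op_fun A v = lambda *: v].

Definition diagonalizable_equation (R : realType) (V : completeNormedModType R)
    (ip : {dot V for (idfun : R -> R)}) (A0 A1 M : linear_operator V)
    (h : nat -> V) (rho nu mu : nat -> R) : Prop :=
  complete_orthonormal ip h /\
  forall k, [/\ eigenpair A0 (rho k) (h k),
                eigenpair A1 (nu k) (h k)
              & eigenpair M (mu k) (h k)].

Definition solution_coef d (Omega : measurableType d) (R : realType)
    (P : probability Omega R) (W : R -> {RV P >-> R}) (H theta : R)
    (rho nu mu : nat -> R) (c : nat -> R) (k : nat) (t : R) (w : Omega) : R :=
  c k * expR ((rho k + theta * nu k) * t
              - 2^-1 * mu k ^+ 2 * t `^ (2 * H) + mu k * W t w).

(* The solution of du = (A0 + theta A1) u dt + M u dW^H, u(0) = u0, for a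
   diagonalizable equation. *)
Definition is_solution d (Omega : measurableType d) (R : realType)
    (P : probability Omega R) (W : R -> {RV P >-> R}) (H theta : R)
    (V : completeNormedModType R) (ip : {dot V for (idfun : R -> R)})
    (h : nat -> V) (rho nu mu : nat -> R) (u0 : V) (u : R -> Omega -> V)
    : Prop :=
  forall t : R, 0 <= t ->
    {ae P, forall w : Omega,
      series (fun k => solution_coef W H theta rho nu mu
                         (fun j => ip u0 (h j)) k t w *: h k) @ \oo
        --> u t w}.

(* v_k = ln (u_k(t) / u_k(0)), from the initial value x0 and the value x of
   the solution at time t. *)
Definition log_ratio (R : realType) (V : completeNormedModType R)
    (ip : {dot V for (idfun : R -> R)}) (h : nat -> V) (x0 x : V) (k : nat)
    : R :=
  ln (ip x (h k) / ip x0 (h k)).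

(* Eliminating W^H(t) from
     v_i = (rho_i + theta nu_i) t - mu_i^2 t^(2H) / 2 + mu_i W^H(t), i = k, m,
   gives
     (rho_k + theta nu_k) t mu_m - (rho_m + theta nu_m) t mu_k
       - v_k mu_m + v_m mu_k = mu_k mu_m (mu_k - mu_m) t^(2H) / 2;
   the expression below is this equation solved for t^(2H), whence the
   factor 2 in the numerator. *)
Definition hurst_log_arg (R : realType) (theta : R) (rho nu mu : nat -> R)
    (v : nat -> R) (k m : nat) (t : R) : R :=
  2 * ((rho k + theta * nu k) * t * mu m - (rho m + theta * nu m) * t * mu k
       - v k * mu m + v m * mu k)
  / (mu k * mu m * (mu k - mu m)).

(* Main.v *)
Require Import Defs.
From HB Require Import structures.
From mathcomp Require Import all_boot all_order all_algebra.
From mathcomp Require Import all_classical all_reals all_analysis.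
From mathcomp Require Import ring.
Set Implicit Arguments.
Unset Strict Implicit.
Unset Printing Implicit Defensive.
Import Order.TTheory GRing.Theory Num.Theory.
Import numFieldNormedType.Exports.
Local Open Scope classical_set_scope.
Local Open Scope ring_scope.

(** Each Fourier coefficient of the solution is driven by the same value of
the noise, so two of them at one time [t] give two equations
  [v_i = (rho_i + theta nu_i) t - mu_i^2 t^(2H) / 2 + mu_i W(t)]
that are linear in the two unknowns [W(t)] and [t^(2H)].  Eliminating [W(t)]
([hurst_log_arg_closed_form]) leaves [t^(2H)], and the logarithm recovers [H]
because [t != 1].

The solution is given only as the almost sure limit of its Fourier series, so
the observed coefficient [<u(t), h_k>] first has to be identified with the
explicit exponential.  This is continuity of [<-, h_k>] for the Hilbert norm
([ip_unit_le_norm], [ip_series_limit]).  The series converges off one null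
set, which serves the indices [k] and [m] simultaneously; off it the identity
holds path by path. *)

Lemma ip_ge0 (R : realType) (V : completeNormedModType R)
    (ip : {dot V for (idfun : R -> R)}) (x : V) : 0 <= ip x x.
Proof.
have [->|x0] := eqVneq x 0; first by rewrite linear0l.
exact/ltW/neq0_dnorm_gt0.
Qed.

Lemma ip_sym (R : realType) (V : completeNormedModType R)
    (ip : {dot V for (idfun : R -> R)}) (x y : V) : ip x y = ip y x.
Proof. by rewrite hermitian_subproof expr0 mul1r. Qed.

(** Bessel's inequality for one unit vector: the residual [x - <x, e> e] has
squared norm [<x, x> - <x, e>^2], which is nonnegative. *)
Lemma ip_unit_le_norm (R : realType) (V : completeNormedModType R)
    (ip : {dot V for (idfun : R -> R)})
    (norm_ip : forall x : V, `|x| = Num.sqrt (ip x x)) (e x : V) :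
  ip e e = 1 -> `|ip x e| <= `|x|.
Proof.
move=> e1; rewrite norm_ip -sqrtr_sqr ler_wsqrtr //.
have := ip_ge0 ip (x - ip x e *: e).
rewrite linearBl !linearBr !linearZl_LR !linearZr_LR /= e1 (ip_sym ip e x).
by rewrite mulr1 -[_ *: _]/(_ * _) subrr subr0 subr_ge0 expr2.
Qed.

(** Past index [j], every partial sum has [j]-th coefficient [c j]; hence
so does the limit. *)
Lemma ip_series_limit (R : realType) (V : completeNormedModType R)
    (ip : {dot V for (idfun : R -> R)})
    (norm_ip : forall x : V, `|x| = Num.sqrt (ip x x))
    (h : nat -> V) (c : nat -> R) (x : V) (j : nat) :
  (forall i k, ip (h i) (h k) = (i == k)%:R) ->
  series (fun k => c k *: h k) @ \oo --> x -> ip x (h j) = c j.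
Proof.
move=> orth cvgx; apply/eqP; rewrite -subr_eq0 -normr_le0.
apply/ler_addgt0Pr => e e0; rewrite add0r.
near \oo => n.
have <- : ip (series (fun k => c k *: h k) n) (h j) = c j.
  rewrite /series /= linear_sumlz (bigD1_seq j) ?iota_uniq //=; last first.
    by rewrite mem_index_iota /=; near: n; exact: nbhs_infty_gt.
  rewrite linearZl_LR /= orth eqxx mulr1 big1 ?addr0 // => i ij.
  by rewrite linearZl_LR /= orth (negbTE ij) mulr0.
rewrite -linearBl; apply: le_trans (ip_unit_le_norm norm_ip _ _) _.
  by rewrite orth eqxx.
by apply/ltW; near: n; move/cvgrPdist_lt: cvgx; exact.
Unshelve. all: by end_near. Qed.

(** The linear system of the two log-ratios, solved for [T = t^(2H)]: the
combination [mu_m v_k - mu_k v_m] is free of the noise value [b]. *)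
Lemma hurst_log_arg_closed_form (R : realType) (theta : R)
    (rho nu mu v : nat -> R) (k m : nat) (t T b : R) :
  mu k * mu m * (mu k - mu m) != 0 ->
  (forall i, i = k \/ i = m ->
    v i = (rho i + theta * nu i) * t - 2^-1 * mu i ^+ 2 * T + mu i * b) ->
  hurst_log_arg theta rho nu mu v k m t = T.
Proof.
move=> nz vE; rewrite /hurst_log_arg !vE; [|by right|by left].
have -> : 2 * ((rho k + theta * nu k) * t * mu m
    - (rho m + theta * nu m) * t * mu k
    - ((rho k + theta * nu k) * t - 2^-1 * mu k ^+ 2 * T + mu k * b) * mu m
    + ((rho m + theta * nu m) * t - 2^-1 * mu m ^+ 2 * T + mu m * b) * mu k)
  = T * (mu k * mu m * (mu k - mu m)) by field.
by rewrite mulfK.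
Qed.

Theorem mainTheorem5 (R : realType)
    (d : measure_display) (Omega : measurableType d) (P : probability Omega R)
    (V : completeNormedModType R) (ip : {dot V for (idfun : R -> R)})
    (hV : separable_hilbert ip)
    (A0 A1 M : linear_operator V)
    (h : nat -> V) (rho nu mu : nat -> R)
    (hdiag : diagonalizable_equation ip A0 A1 M h rho nu mu)
    (H theta : R) (hH0 : 0 < H) (hH1 : H < 1)
    (W : R -> {RV P >-> R}) (hW : fractional_brownian_motion H W)
    (u0 : V) (u : R -> Omega -> V)
    (hu : is_solution W H theta ip h rho nu mu u0 u)
    (k m : nat) (hkm : k != m)
    (huk : ip u0 (h k) != 0) (hum : ip u0 (h m) != 0)
    (hfin : mu k * mu m * (mu k - mu m) != 0)
    (t : R) (ht0 : 0 < t) (ht1 : t != 1) :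
  {ae P, forall w : Omega,
    0 < hurst_log_arg theta rho nu mu (log_ratio ip h u0 (u t w)) k m t ->
    H = (2 * ln t)^-1
        * ln (hurst_log_arg theta rho nu mu (log_ratio ip h u0 (u t w)) k m t)}.
Proof.
have [norm_ip _] := hV; have [[orth _] _] := hdiag.
apply: filterS (hu t (ltW ht0)) => w cvgu _.
set v := log_ratio ip h u0 (u t w).
have vE i : i = k \/ i = m -> v i = (rho i + theta * nu i) * t
    - 2^-1 * mu i ^+ 2 * t `^ (2 * H) + mu i * W t w.
  move=> ikm; have nz : ip u0 (h i) != 0 by case: ikm => ->.
  by rewrite /v /log_ratio (ip_series_limit norm_ip i orth cvgu)
    /solution_coef mulrAC divff // mul1r expRK.
rewrite (hurst_log_arg_closed_form hfin vE) ln_powR.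
have lnt : ln t != 0 by rewrite ln_eq0.
by field.
Qed.
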